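(* Let $M\in\mathbb{C}$ satisfy $\Re M>0$, and let $$b_0=M-1,\qquad b_{2n-1}=\frac{2M}{n},\qquad b_{2n}=\frac{M(2n+1)}{n(n+1)},\qquad n\in\{1,2,3,\ldots\}.$$ Then the continued fraction $b_0+\mathop{\mathbf{K}}_{n=1}^{\infty}\frac{1}{b_n}$ converges and $$2M^3\,\Phi(1,3,M+1)=2M^3\,\zeta(3,M+1)=b_0+\mathop{\mathbf{K}}_{n=1}^{\infty}\frac{1}{b_n}.$$
   Context: The Lerch transcendent is $\Phi(z,s,a)=\sum_{n=0}^{\infty}\frac{z^n}{(n+a)^s}$ for $a\notin\{0,-1,-2,\ldots\}$, and the Hurwitz zeta function is $\zeta(s,a)=\Phi(1,s,a)$; in particular $\zeta(3,M+1)=\sum_{n=0}^\infty \frac{1}{(n+M+1)^3}$. For complex sequences $(a_n)_{n\ge1}$, $(b_n)_{n\ge 0}$, the continued fraction $b_0+\mathop{\mathbf{K}}_{n=1}^{\infty}\frac{a_n}{b_n}=b_0+\cfrac{a_1}{b_1+\cfrac{a_2}{b_2+\cdots}}$ has convergents $f_n=A_n/B_n$, where $A_{-1}=1$, $A_0=b_0$, $B_{-1}=0$, $B_0=1$, and $A_n=b_nA_{n-1}+a_nA_{n-2}$, $B_n=b_nB_{n-1}+a_nB_{n-2}$ for $n\ge1$. The continued fraction converges, with value $f$, if $\lim_{n\to\infty}f_n=f$ exists. Here all partial numerators are $a_n=1$. *)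

(* Defs.v *)
(* Stdlib reals, with Coquelicot's complex numbers [C]. *)
From Stdlib Require Import Reals.
From Coquelicot Require Import Coquelicot.

Open Scope C_scope.

(* The order [s] is a natural number, so that [w ^ s] involves no choice of a
   branch of the complex power. *)
Definition lerch_term (z : C) (s : nat) (a : C) (n : nat) : C :=
  z ^ n / (RtoC (INR n) + a) ^ s.

Definition ex_lerch (z : C) (s : nat) (a : C) : Prop :=
  ex_series (V := C_NormedModule) (lerch_term z s a).

(* [iota P] is the unique element satisfying [P]; its value is meaningless when
   the series diverges, hence the companion predicate [ex_lerch]. *)
Definition lerch (z : C) (s : nat) (a : C) : C :=
  @iota C_CompleteNormedModule
    (fun l : C => is_series (V := C_NormedModule) (lerch_term z s a) l).

Definition hurwitz_zeta (s : nat) (a : C) : C := lerch 1 s a.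

(* Solution [X] of [X_n = b_n X_(n-1) + a_n X_(n-2)] for [n >= 1] with the given
   values of [X_0] and [X_(-1)]; the pair at [n] is [(X_n, X_(n-1))].
   The entries [a 0] and [b 0] are not used here. *)
Fixpoint cfrac_rec (a b : nat -> C) (X0 Xm1 : C) (n : nat) : C * C :=
  match n with
  | O => (X0, Xm1)
  | S m =>
      let '(X1, X2) := cfrac_rec a b X0 Xm1 m in
      (b n * X1 + a n * X2, X1)
  end.

Definition cfrac_num (a b : nat -> C) (n : nat) : C :=
  fst (cfrac_rec a b (b O) 1 n).

Definition cfrac_den (a b : nat -> C) (n : nat) : C :=
  fst (cfrac_rec a b 1 0 n).

Definition convergent (a b : nat -> C) (n : nat) : C :=
  cfrac_num a b n / cfrac_den a b n.

(* Since division by zero is total, convergence asks explicitly that all but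
   finitely many convergents be genuine quotients. *)
Definition is_cfrac (a b : nat -> C) (f : C) : Prop :=
  eventually (fun n => cfrac_den a b n <> 0) /\
  filterlim (convergent a b) eventually (locally (T := C_UniformSpace) f).

Definition ex_cfrac (a b : nat -> C) : Prop := exists f : C, is_cfrac a b f.

Definition cfrac (a b : nat -> C) : C :=
  @iota C_CompleteNormedModule (is_cfrac a b).

(* Main.v *)
Require Import Defs.
From Stdlib Require Import Reals Lra Lia FunctionalExtensionality.
From Coquelicot Require Import Coquelicot.
Open Scope C_scope.

(** Write [f_n(M) = A_n / B_n] for the convergents.  All the elements [b_n],
    [n >= 1], are positive multiples of [M], so they lie in the open right
    half-plane, and everything rests on two facts.

    First, as for every continued fraction with partial numerators 1 and
    elements in the right half-plane, the number
    [S_n = Re (B_n * conj B_(n-1))] increases with [n], and a modified convergent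
    [(A_n p + A_(n-1) q) / (B_n p + B_(n-1) q)] with [Re (p * conj q) >= 0] is at
    distance at most [1 / S_n] from [f_n] ([disc_bound]).  Later convergents are
    of this form ([absorb_tail]), so the continued fraction converges as soon as
    [S_n] tends to infinity; here this follows from the divergence of the
    harmonic series ([inv_diameter_lim]).

    Second, the recurrences at [M] and at [M + 1] are contiguous: a combination
    of [X_(2m)] and [X_(2m-1)] with coefficients quadratic in [m] turns each
    solution at [M] into a solution at [M + 1] ([contiguity]).  Applied to
    numerators and denominators, this says that
    [(M / (M+1))^3 * (f_2m(M+1) + 2)] is a modified convergent at [M], and the
    ratio [p / q] of its weights tends to 1, hence ends up in the right
    half-plane.  By the first fact the values [G] of the continued fractions
    satisfy [(M / (M+1))^3 * (G(M+1) + 2) = G(M)] ([in_discs_succ]).  In terms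
    of [H(M) = G(M) / (2 M^3)] this reads [H(M) - H(M+1) = 1 / (M+1)^3].

    Finally [G(Z)] differs from [Z - 1] by at most [1 / Re Z]
    ([in_discs_near]), so [H(M+N)] tends to 0 and the telescoping sum
    identifies [H(M)] with the Hurwitz zeta value. *)

(** * Limits in terms of the modulus *)

Lemma filterlim_Cmod (u : nat -> C) (l : C) :
  filterlim u eventually (locally (T := C_UniformSpace) l) <->
  (forall eps : R, (0 < eps)%R -> eventually (fun n => (Cmod (u n - l) < eps)%R)).
Proof.
  split.
  - intros H eps Heps.
    apply (proj1 (filterlim_locally_ball_norm (U := C_NormedModule) u l) H
             (mkposreal eps Heps)).
  - intros H.
    apply (proj2 (filterlim_locally_ball_norm (U := C_NormedModule) u l)).
    intros [eps Heps]. exact (H eps Heps).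
Qed.

(** * Continued fractions with elements in the right half-plane *)

(** The pair [(A_n, A_(n-1))]; [dens] is the pair [(B_n, B_(n-1))]. *)
Definition nums (b : nat -> C) (n : nat) : C * C :=
  cfrac_rec (fun _ => 1) b (b O) 1 n.
Definition dens (b : nat -> C) (n : nat) : C * C :=
  cfrac_rec (fun _ => 1) b 1 0 n.

Definition comb (x : C * C) (p q : C) : C := fst x * p + snd x * q.

(** The image of the closed right half-plane under
    [w |-> (A_n w + A_(n-1)) / (B_n w + B_(n-1))] is a disc through
    [f_n = A_n / B_n] whose diameter is the inverse of this number, when the
    number is positive. *)
Definition inv_diameter (b : nat -> C) (n : nat) : R :=
  Re (fst (dens b n) * Cconj (snd (dens b n))).

Lemma cfrac_rec_succ b x y n :
  cfrac_rec (fun _ => 1) b x y (S n) =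
    (b (S n) * fst (cfrac_rec (fun _ => 1) b x y n) + snd (cfrac_rec (fun _ => 1) b x y n),
     fst (cfrac_rec (fun _ => 1) b x y n)).
Proof.
  simpl. destruct (cfrac_rec _ b x y n) as [u v]. simpl. f_equal. ring.
Qed.

Lemma Re_step (b x y : C) :
  Re ((b * x + y) * Cconj x) = (Re b * Cmod x ^ 2 + Re (x * Cconj y))%R.
Proof. rewrite Cmod2_alt. destruct b, x, y; simpl; ring. Qed.

Lemma inv_diameter_succ b n :
  inv_diameter b (S n) =
    (Re (b (S n)) * Cmod (fst (dens b n)) ^ 2 + inv_diameter b n)%R.
Proof.
  unfold inv_diameter, dens. rewrite cfrac_rec_succ. cbn [fst snd]. apply Re_step.
Qed.

Lemma Cmod_casoratian b n :
  Cmod (fst (dens b n) * snd (nums b n) - fst (nums b n) * snd (dens b n)) = 1%R.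
Proof.
  unfold dens, nums. induction n as [|n IH].
  - cbn [cfrac_rec fst snd]. replace (1 * 1 - b O * 0) with (RtoC 1) by ring.
    apply Cmod_1.
  - rewrite !cfrac_rec_succ. cbn [fst snd]. etransitivity; [|exact IH].
    rewrite <- Cmod_opp. apply f_equal. ring.
Qed.

(** The numerator of the difference is [q] times a Casoratian of modulus 1, and
    [Re ((B p + B' q) * conj (B q)) = |B|^2 Re (p * conj q) + |q|^2 Re (B * conj B')]
    bounds its denominator from below.  Homogeneous weights [p], [q] include
    the convergent itself ([q = 0]) and avoid dividing. *)
Lemma disc_bound b n p q :
  (0 < inv_diameter b n)%R -> (0 <= Re (p * Cconj q))%R -> (p <> 0 \/ q <> 0) ->
  comb (dens b n) p q <> 0 /\
  (Cmod (comb (nums b n) p q / comb (dens b n) p q - convergent (fun _ => 1) b n)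
     <= / inv_diameter b n)%R.
Proof.
  intros HS Hpq Hne. unfold inv_diameter in *.
  unfold convergent, cfrac_num, cfrac_den, comb.
  fold (nums b n) (dens b n).
  pose proof (Cmod_casoratian b n) as HW.
  destruct (nums b n) as [A A']. destruct (dens b n) as [B B']. cbn [fst snd] in *.
  set (s := Re (B * Cconj B')) in *.
  assert (HB : B <> 0).
  { intros ->. unfold s in HS. rewrite Cmult_0_l in HS. simpl in HS. lra. }
  assert (Hkey : (Cmod q * s <= Cmod (B * p + B' * q) * Cmod B)%R).
  { destruct (Req_dec (Cmod q) 0) as [H0|H0].
    { rewrite H0, Rmult_0_l. apply Rmult_le_pos; apply Cmod_ge_0. }
    assert (Hq : (0 < Cmod q)%R) by (pose proof (Cmod_ge_0 q); lra).
    apply Rmult_le_reg_r with (Cmod q); auto.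
    apply Rle_trans with (Re ((B * p + B' * q) * Cconj (B * q))).
    - replace (Re ((B * p + B' * q) * Cconj (B * q)))
        with (Cmod B ^ 2 * Re (p * Cconj q) + Cmod q ^ 2 * s)%R.
      + pose proof (pow2_ge_0 (Cmod B)).
        assert (0 <= Cmod B ^ 2 * Re (p * Cconj q))%R by (apply Rmult_le_pos; auto).
        lra.
      + unfold s. rewrite !Cmod2_alt. destruct B, B', p, q; simpl; ring.
    - eapply Rle_trans; [apply Rle_abs|]. eapply Rle_trans; [apply re_le_Cmod|].
      rewrite !Cmod_mult, Cmod_conj, Cmod_mult. right; ring. }
  assert (Hnz : B * p + B' * q <> 0).
  { intros H0. rewrite H0, Cmod_0, Rmult_0_l in Hkey.
    assert (Hq : q = 0).
    { apply Cmod_eq_0. pose proof (Cmod_ge_0 q).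
      nra. }
    destruct Hne as [Hp|Hq']; [|contradiction].
    apply Hp. subst q. apply Cmod_eq_0.
    assert (H1 : Cmod (B * p) = 0%R).
    { rewrite <- Cmod_0, <- H0. f_equal. ring. }
    rewrite Cmod_mult in H1. apply Cmod_gt_0 in HB.
    apply Rmult_integral in H1. lra. }
  split; [exact Hnz|].
  replace ((A * p + A' * q) / (B * p + B' * q) - A / B)
    with (q * (B * A' - A * B') / ((B * p + B' * q) * B)) by (field; auto).
  rewrite Cmod_div by (apply Cmult_neq_0; auto).
  rewrite !Cmod_mult, HW, Rmult_1_r.
  apply Cmod_gt_0 in Hnz. apply Cmod_gt_0 in HB.
  apply Rmult_le_reg_r with s; auto. rewrite Rinv_l by lra.
  apply Rmult_le_reg_r with (Cmod (B * p + B' * q) * Cmod B)%R.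
  { apply Rmult_lt_0_compat; auto. }
  unfold Rdiv. rewrite Rmult_1_l. field_simplify; lra.
Qed.

(** Peeling off one step replaces the weights [(p, q)] by [(b p + q, p)], which
    stay in the half-plane region because [Re ((b p + q) * conj p)] is
    [Re b * |p|^2 + Re (q * conj p)].  The weights obtained do not depend on
    the initial values, so they serve numerators and denominators at once. *)
Lemma absorb_tail (b : nat -> C) (Hb : forall n, (0 <= Re (b (S n)))%R) n j :
  forall p q, (0 <= Re (p * Cconj q))%R -> (p <> 0 \/ q <> 0) ->
  exists p' q', (0 <= Re (p' * Cconj q'))%R /\ (p' <> 0 \/ q' <> 0) /\
    forall x y,
      comb (cfrac_rec (fun _ => 1) b x y (n + j)) p q =
      comb (cfrac_rec (fun _ => 1) b x y n) p' q'.
Proof.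
  induction j as [|j IH]; intros p q Hpq Hne.
  - exists p, q. rewrite Nat.add_0_r. auto.
  - destruct (IH (b (S (n + j)) * p + q) p) as (p' & q' & H1 & H2 & H3).
    + rewrite Re_step.
      pose proof (Rmult_le_pos _ _ (Hb (n + j)%nat) (pow2_ge_0 (Cmod p))). lra.
    + destruct (Ceq_dec p 0) as [->|Hp]; [|auto].
      left. destruct Hne as [Hne|Hne]; [now destruct Hne|].
      now rewrite Cmult_0_r, Cplus_0_l.
    + exists p', q'. repeat split; auto. intros x y. rewrite <- H3.
      rewrite Nat.add_succ_r, cfrac_rec_succ. unfold comb. cbn [fst snd]. ring.
Qed.

(** The value of the continued fraction, described by explicit error bounds
    instead of a limit.  The functional equation needs the rate for modified
    convergents anyway, and the bound at [n = 1] alone locates the value well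
    enough for the summation. *)
Definition in_discs (b : nat -> C) (f : C) : Prop :=
  forall n, (0 < inv_diameter b n)%R ->
    (Cmod (convergent (fun _ => 1) b n - f) <= / inv_diameter b n)%R.

Lemma inv_diameter_le b (Hb : forall n, (0 <= Re (b (S n)))%R) n j :
  (inv_diameter b n <= inv_diameter b (n + j))%R.
Proof.
  induction j as [|j IH].
  - rewrite Nat.add_0_r. lra.
  - rewrite Nat.add_succ_r, inv_diameter_succ.
    pose proof (Rmult_le_pos _ _ (Hb (n + j)%nat)
                  (pow2_ge_0 (Cmod (fst (dens b (n + j)))))). lra.
Qed.

Lemma convergent_in_disc b (Hb : forall n, (0 <= Re (b (S n)))%R) n j :
  (0 < inv_diameter b n)%R ->
  (Cmod (convergent (fun _ => 1) b (n + j) - convergent (fun _ => 1) b n)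
     <= / inv_diameter b n)%R.
Proof.
  intros HS.
  assert (H10 : (0 <= Re (1 * Cconj 0))%R) by (simpl; lra).
  assert (H11 : (RtoC 1 <> 0 \/ RtoC 0 <> 0)) by (left; apply C1_nz).
  destruct (absorb_tail b Hb n j 1 0 H10 H11) as (p & q & H1 & H2 & H3).
  destruct (disc_bound b n p q HS H1 H2) as [_ H].
  unfold nums, dens in H. rewrite <- !H3 in H. unfold comb in H.
  rewrite !Cmult_1_r, !Cmult_0_r, !Cplus_0_r in H. exact H.
Qed.

(** The convergents form a Cauchy sequence, since all those after the [n]-th are
    within [1 / S_n] of it; the bound persists in the limit. *)
Lemma in_discs_exists b (Hb : forall n, (0 <= Re (b (S n)))%R)
  (HS : is_lim_seq (inv_diameter b) p_infty) :
  exists f, in_discs b f.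
Proof.
  apply is_lim_seq_spec in HS.
  assert (Hc : forall eps : posreal, exists P, eventually P /\
            forall i j, P i -> P j ->
              ball (M := C_UniformSpace)
                (convergent (fun _ => 1) b i) eps (convergent (fun _ => 1) b j)).
  { intros eps. destruct (HS (2 / eps)%R) as [N HN].
    pose proof (cond_pos eps) as He.
    assert (H2 : (0 < 2 / eps)%R) by (apply Rdiv_lt_0_compat; lra).
    exists (fun n => (N <= n)%nat). split; [now exists N|].
    intros i j Hi Hj.
    specialize (HN N (le_n _)). cbn beta in HN.
    apply (norm_compat1 (V := C_NormedModule)).
    change (Cmod (convergent (fun _ => 1) b j - convergent (fun _ => 1) b i) < eps)%R.
    assert (HN0 : (0 < inv_diameter b N)%R) by lra.
    pose proof (convergent_in_disc b Hb N (i - N) HN0) as Ei.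
    pose proof (convergent_in_disc b Hb N (j - N) HN0) as Ej.
    replace (N + (i - N))%nat with i in Ei by lia.
    replace (N + (j - N))%nat with j in Ej by lia.
    set (u := convergent _ b i) in *. set (v := convergent _ b j) in *.
    set (w := convergent _ b N) in *.
    replace (v - u) with ((v - w) + (- (u - w))) by ring.
    eapply Rle_lt_trans; [apply Cmod_triangle|]. rewrite Cmod_opp.
    assert (/ inv_diameter b N < / (2 / eps))%R by (apply Rinv_lt_contravar; nra).
    replace (/ (2 / eps))%R with (eps / 2)%R in H by (field; lra). lra. }
  apply (proj1 (filterlim_locally_cauchy (U := CompleteNormedModule.CompleteSpace _ C_CompleteNormedModule) _)) in Hc.
  destruct Hc as [f Hf]. exists f. intros n Hn.
  pose proof (proj1 (filterlim_Cmod _ _) Hf) as Hf'.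
  apply Rnot_lt_le. intros Hlt.
  destruct (Hf' _ (proj2 (Rlt_0_minus _ _) Hlt)) as [N HN].
  specialize (HN (n + N)%nat ltac:(lia)). cbn beta in HN.
  pose proof (convergent_in_disc b Hb n N Hn) as E.
  set (u := convergent _ b (n + N)) in *. set (v := convergent _ b n) in *.
  assert (Cmod (v - f) <= Cmod (u - v) + Cmod (u - f))%R.
  { rewrite <- (Cmod_opp (u - v)).
    replace (v - f) with (- (u - v) + (u - f)) by ring. apply Cmod_triangle. }
  lra.
Qed.

(** [S_n > 0] also forces [B_n <> 0], so that the convergents are genuine
    quotients. *)
Lemma in_discs_is_cfrac b f (HS : is_lim_seq (inv_diameter b) p_infty) :
  in_discs b f -> is_cfrac (fun _ => 1) b f.
Proof.
  intros Hf. apply is_lim_seq_spec in HS. split.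
  - destruct (HS 0%R) as [N HN]. exists N. intros n Hn H0.
    specialize (HN n Hn). unfold inv_diameter, dens in HN.
    unfold cfrac_den in H0. rewrite H0, Cmult_0_l in HN. simpl in HN. lra.
  - apply filterlim_Cmod. intros eps He.
    destruct (HS (/ eps)%R) as [N HN]. exists N. intros n Hn.
    specialize (HN n Hn). cbn beta in HN.
    pose proof (Rinv_0_lt_compat _ He).
    eapply Rle_lt_trans; [apply Hf; lra|].
    rewrite <- (Rinv_inv eps). apply Rinv_lt_contravar; [|lra].
    apply Rmult_lt_0_compat; lra.
Qed.

(** Writing [S_n] for [inv_diameter b n], [S_(n+1) - S_(n-1)] is at least
    [d_n (|B_n|^2 + |B_(n-1)|^2) >= 2 d_n |B_n B_(n-1)| >= 2 d_n S_n], and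
    [S_n >= S_1 > 0].  Pairing two consecutive steps avoids estimating [|B_n|]
    alone. *)
Lemma inv_diameter_lim b (d : nat -> R)
  (Hd : forall n, (0 <= d (S n) <= d n)%R)
  (Hdb : forall n, (d n <= Re (b (S n)))%R)
  (Hb1 : (0 < Re (b 1%nat))%R)
  (Hsum : is_lim_seq (sum_n d) p_infty) :
  is_lim_seq (inv_diameter b) p_infty.
Proof.
  set (s := Re (b 1%nat)).
  assert (Hb : forall n, (0 <= Re (b (S n)))%R).
  { intros n. specialize (Hd n). specialize (Hdb n). lra. }
  assert (H1 : inv_diameter b 1 = s).
  { rewrite inv_diameter_succ. unfold inv_diameter, dens. simpl.
    rewrite Cmod_1. unfold s. ring. }
  assert (Hs : forall n, (s <= inv_diameter b (S n))%R).
  { intros n. rewrite <- H1. apply (inv_diameter_le b Hb 1 n). }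
  (* Leaving out the first two terms of the sum makes the base case trivial. *)
  assert (Hgrow : forall n, (2 * s * (sum_n d (S n) - (d 0%nat + d 1%nat))
            <= inv_diameter b (S (S n)) + inv_diameter b (S n))%R).
  { induction n as [|n IH].
    - rewrite sum_Sn, sum_O. unfold plus; simpl.
      pose proof (Hs 0%nat). pose proof (Hs 1%nat). unfold s in *. lra.
    - rewrite sum_Sn. unfold plus; simpl.
      set (X := Cmod (fst (dens b (S n)))). set (Y := Cmod (fst (dens b (S (S n))))).
      assert (EX : inv_diameter b (S (S n)) = (Re (b (S (S n))) * X ^ 2 + inv_diameter b (S n))%R)
        by apply inv_diameter_succ.
      assert (EY : inv_diameter b (S (S (S n))) = (Re (b (S (S (S n)))) * Y ^ 2 + inv_diameter b (S (S n)))%R)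
        by apply inv_diameter_succ.
      assert (HXY : (s <= X * Y)%R).
      { eapply Rle_trans; [apply (Hs (S n))|].
        unfold inv_diameter. eapply Rle_trans; [apply Rle_abs|].
        eapply Rle_trans; [apply re_le_Cmod|].
        rewrite Cmod_mult, Cmod_conj. unfold dens at 2. rewrite cfrac_rec_succ.
        cbn [snd]. unfold X, Y, dens. lra. }
      pose proof (Hdb (S n)) as D1. pose proof (Hdb (S (S n))) as D2.
      pose proof (Hd (S n)) as D3.
      pose proof (pow2_ge_0 X) as PX. pose proof (pow2_ge_0 Y) as PY.
      assert (d (S (S n)) * X ^ 2 <= Re (b (S (S n))) * X ^ 2)%R
        by (apply Rmult_le_compat_r; lra).
      assert (d (S (S n)) * Y ^ 2 <= Re (b (S (S (S n)))) * Y ^ 2)%R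
        by (apply Rmult_le_compat_r; lra).
      assert (d (S (S n)) * (2 * s) <= d (S (S n)) * (X ^ 2 + Y ^ 2))%R.
      { apply Rmult_le_compat_l; [lra|]. pose proof (pow2_ge_0 (X - Y)). nra. }
      lra. }
  apply is_lim_seq_spec. apply is_lim_seq_spec in Hsum.
  intros K. assert (s_pos : (0 < s)%R) by exact Hb1.
  destruct (Hsum (K / s + d 0%nat + d 1%nat)%R) as [N HN].
  exists (S (S N)). intros n Hn.
  destruct n as [|[|n]]; [lia|lia|].
  specialize (HN (S n) ltac:(lia)). cbn beta in HN.
  specialize (Hgrow n).
  pose proof (inv_diameter_le b Hb (S n) 1) as Hm. rewrite Nat.add_1_r in Hm.
  assert (K < s * (sum_n d (S n) - (d 0%nat + d 1%nat)))%R.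
  { replace K with (s * (K / s))%R by (field; lra).
    apply Rmult_lt_compat_l; lra. }
  lra.
Qed.

(** Comparison with [ln (n + 2)], using [ln (1 + 1/x) <= 1/x]. *)
Lemma harmonic_diverges : is_lim_seq (sum_n (fun n => / INR (S n))%R) p_infty.
Proof.
  apply is_lim_seq_le_p_loc with (fun n => ln (INR (n + 2))).
  - exists 0%nat. intros n _. induction n as [|n IH].
    + rewrite sum_O. simpl. pose proof (exp_ineq1 1 ltac:(lra)).
      rewrite Rinv_1. rewrite <- (ln_exp 1) at 3.
      apply Rlt_le, ln_increasing; lra.
    + rewrite sum_Sn. change (plus ?x ?y) with (x + y)%R.
      eapply Rle_trans; [|apply Rplus_le_compat_r, IH].
      set (x := INR (n + 2)).
      assert (Hx : (0 < x)%R) by (apply lt_0_INR; lia).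
      assert (E1 : INR (S n + 2) = (x + 1)%R)
        by (unfold x; rewrite <- S_INR; f_equal; lia).
      assert (E2 : INR (S (S n)) = x) by (unfold x; f_equal; lia).
      rewrite E1, E2.
      assert (Hi : (0 < / x)%R) by now apply Rinv_0_lt_compat.
      replace (x + 1)%R with (x * (1 + / x))%R by (field; lra).
      rewrite ln_mult by lra. apply Rplus_le_compat_l.
      rewrite <- (ln_exp (/ x)) at 2. apply Rlt_le, ln_increasing; [lra|].
      apply exp_ineq1; lra.
  - apply filterlim_comp with (2 := is_lim_ln_p).
    exact (proj1 (is_lim_seq_incr_n INR 2 p_infty) is_lim_seq_INR).
Qed.

(** * The recurrence and its contiguity in [M] *)

(** The elements of the statement, written in terms of the index itself rather
    than of its half. *)
Definition elem (M : C) (n : nat) : C :=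
  match n with
  | O => M - 1
  | _ => M * RtoC (if Nat.even n then 4 * (INR n + 1) / (INR n * (INR n + 2))
                   else 4 / (INR n + 1))
  end.

Lemma elem_odd M m : elem M (2 * m + 1) = 2 * M / (RtoC (INR m) + 1).
Proof.
  unfold elem. replace (2 * m + 1)%nat with (S (2 * m)) by lia.
  cbv beta iota. rewrite Nat.even_succ, <- Nat.negb_even, Nat.even_even. cbn [negb].
  pose proof (pos_INR m). rewrite S_INR, mult_INR.
  replace (4 / (INR 2 * INR m + 1 + 1))%R with (2 / (INR m + 1))%R
    by (simpl; field; lra).
  rewrite RtoC_div, RtoC_plus by lra. unfold Cdiv. ring.
Qed.

Lemma elem_even M m :
  elem M (2 * m + 2) =
    M * (2 * RtoC (INR m) + 3) / ((RtoC (INR m) + 1) * (RtoC (INR m) + 2)).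
Proof.
  unfold elem. replace (2 * m + 2)%nat with (S (S (2 * m))) by lia.
  cbv beta iota. rewrite Nat.even_succ_succ, Nat.even_even.
  pose proof (pos_INR m). rewrite !S_INR, mult_INR.
  match goal with |- context [RtoC ?x] =>
    replace x with ((2 * INR m + 3) / ((INR m + 1) * (INR m + 2)))%R
    by (simpl; field; lra) end.
  rewrite RtoC_div, RtoC_mult, !RtoC_plus, RtoC_mult by nra.
  unfold Cdiv. ring.
Qed.

Lemma INR_succ_nz m k : RtoC (INR m) + RtoC (INR (S k)) <> 0.
Proof.
  rewrite <- RtoC_plus, <- plus_INR. intros E. apply RtoC_inj in E.
  apply (not_0_INR (m + S k)); [lia|exact E].
Qed.

(** For [n = 2 m] the pairs [(X_n, X_(n-1))] at [M] and [M + 1] are related by a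
    matrix with entries quadratic in [m], here normalized so that [m^2] has
    coefficient 1.  It is forced by the functional equation: [B_n]
    must go to a multiple of [B_n(M+1)] and [A_n] to a multiple of
    [A_n(M+1) + 2 B_n(M+1)].  That it maps solutions to solutions is a rational
    identity checked over two steps of the recurrences. *)
Lemma contiguity M (HM : 2 * M + 1 <> 0) x0 y0 x0' y0' :
  x0' = (M + 1) ^ 3 / (2 * M + 1) * x0 + y0 ->
  y0' = M ^ 3 / (2 * M + 1) * y0 ->
  forall m : nat,
  let k := RtoC (INR m) in
  let X := cfrac_rec (fun _ => 1) (elem M) x0 y0 (2 * m) in
  let X' := cfrac_rec (fun _ => 1) (elem (M + 1)) x0' y0' (2 * m) in
  fst X' = comb X (k ^ 2 + (M + 2) * k + (M + 1) ^ 3 / (2 * M + 1)) ((k + 1) ^ 2) /\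
  snd X' = comb X (k * (k + 1)) (k ^ 2 - (M - 1) * k + M ^ 3 / (2 * M + 1)).
Proof.
  intros Hx Hy m. cbv zeta. induction m as [|m IH].
  - change (2 * 0)%nat with 0%nat. cbn [cfrac_rec]. unfold comb. cbn [fst snd]. rewrite Hx, Hy.
    simpl (INR 0). split; field; auto.
  - replace (2 * S m)%nat with (S (2 * m + 1)) by lia.
    rewrite !cfrac_rec_succ. replace (2 * m + 1)%nat with (S (2 * m)) by lia.
    rewrite !cfrac_rec_succ. cbn [fst snd].
    replace (S (S (2 * m))) with (2 * m + 2)%nat by lia.
    replace (S (2 * m)) with (2 * m + 1)%nat by lia.
    rewrite !elem_odd, !elem_even.
    rewrite S_INR, RtoC_plus.
    destruct (cfrac_rec (fun _ => 1) (elem M) x0 y0 (2 * m)) as [x y].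
    destruct (cfrac_rec (fun _ => 1) (elem (M + 1)) x0' y0' (2 * m)) as [x' y'].
    unfold comb in *. cbn [fst snd] in *. destruct IH as [-> ->].
    pose proof (INR_succ_nz m 0) as H1. pose proof (INR_succ_nz m 1) as H2.
    simpl (INR 1) in H1. simpl (INR 2) in H2. replace (1+1)%R with 2%R in H2 by ring.
    set (k := RtoC (INR m)) in *.
    split; field; auto.
Qed.

(** * Convergence for positive real part *)

Lemma Re_mult_R (z : C) (r : R) : Re (z * RtoC r) = (Re z * r)%R.
Proof. destruct z; simpl; ring. Qed.

Lemma Re_plus_R (z : C) (r : R) : Re (z + RtoC r) = (Re z + r)%R.
Proof. reflexivity. Qed.

Lemma Re_elem_ge M (HM : (0 < Re M)%R) n :
  (2 * Re M * / INR (S n) <= Re (elem M (S n)))%R.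
Proof.
  unfold elem. rewrite Re_mult_R, S_INR.
  pose proof (pos_INR n) as Hn. set (x := INR n) in *.
  rewrite (Rmult_comm 2), Rmult_assoc. apply Rmult_le_compat_l; [lra|].
  assert (H : (0 <= x * (x + 1))%R) by nra.
  destruct (Nat.even (S n)); apply Rminus_le_0.
  - replace (4 * (x + 1 + 1) / ((x + 1) * (x + 1 + 2)) - 2 * / (x + 1))%R
      with (2 / (x + 3))%R by (field; lra).
    apply Rlt_le, Rdiv_lt_0_compat; lra.
  - replace (4 / (x + 1 + 1) - 2 * / (x + 1))%R
      with (2 * x / ((x + 1) * (x + 2)))%R by (field; lra).
    apply Rmult_le_pos; [lra|]. apply Rlt_le, Rinv_0_lt_compat. nra.
Qed.

Lemma Re_elem_pos M (HM : (0 < Re M)%R) n : (0 < Re (elem M (S n)))%R.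
Proof.
  eapply Rlt_le_trans; [|apply (Re_elem_ge M HM)].
  apply Rmult_lt_0_compat; [lra|]. apply Rinv_0_lt_compat, lt_0_INR. lia.
Qed.

Lemma inv_diameter_elem_lim M (HM : (0 < Re M)%R) :
  is_lim_seq (inv_diameter (elem M)) p_infty.
Proof.
  apply inv_diameter_lim with (fun n => (2 * Re M * / INR (S n))%R).
  - intros n. assert (0 < INR (S n))%R by (apply lt_0_INR; lia).
    rewrite (S_INR (S n)). split.
    + apply Rmult_le_pos; [lra|]. apply Rlt_le, Rinv_0_lt_compat. lra.
    + apply Rmult_le_compat_l; [lra|]. apply Rinv_le_contravar; lra.
  - apply Re_elem_ge, HM.
  - apply Re_elem_pos, HM.
  - apply is_lim_seq_ext with
      (fun n => (2 * Re M * sum_n (fun k => / INR (S k)) n)%R).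
    + intros n. symmetry. apply (sum_n_mult_l (K := R_Ring)).
    + replace p_infty with (Rbar_mult (2 * Re M)%R p_infty).
      * apply is_lim_seq_scal_l, harmonic_diverges.
      * apply is_Rbar_mult_unique, is_Rbar_mult_sym, is_Rbar_mult_p_infty_pos.
        simpl. lra.
Qed.

Lemma Re_pos_nz (z : C) : (0 < Re z)%R -> z <> 0.
Proof. intros H E. rewrite E in H. simpl in H. lra. Qed.

(** * The functional equation *)

Lemma cfrac_rec_lin b s t x y u v n :
  cfrac_rec (fun _ => 1) b (s * x + t * u) (s * y + t * v) n =
    (s * fst (cfrac_rec (fun _ => 1) b x y n) + t * fst (cfrac_rec (fun _ => 1) b u v n),
     s * snd (cfrac_rec (fun _ => 1) b x y n) + t * snd (cfrac_rec (fun _ => 1) b u v n)).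
Proof.
  induction n as [|n IH]; [reflexivity|].
  rewrite !cfrac_rec_succ, IH. cbn [fst snd]. f_equal. ring.
Qed.

(** Contiguity for denominators carries the factor [(M+1)^3 / (2M+1)], and for
    numerators [M^3 / (2M+1)] together with the shift by 2. *)
Lemma modified_convergent_shift M (HM : (0 < Re M)%R) m :
  let k := RtoC (INR m) in
  let p := k ^ 2 + (M + 2) * k + (M + 1) ^ 3 / (2 * M + 1) in
  let q := (k + 1) ^ 2 in
  comb (dens (elem M) (2 * m)) p q <> 0 ->
  comb (nums (elem M) (2 * m)) p q / comb (dens (elem M) (2 * m)) p q =
    (M / (M + 1)) ^ 3 * (convergent (fun _ => 1) (elem (M + 1)) (2 * m) + 2).
Proof.
  intros k p q Hnz.
  assert (H0 : M <> 0) by (apply Re_pos_nz; auto).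
  assert (H1 : M + 1 <> 0) by (apply Re_pos_nz; rewrite Re_plus_R; lra).
  assert (H2 : 2 * M + 1 <> 0).
  { apply Re_pos_nz. destruct M. simpl in *. lra. }
  assert (ED : comb (dens (elem M) (2 * m)) p q =
    (M + 1) ^ 3 / (2 * M + 1) * fst (dens (elem (M + 1)) (2 * m))).
  { destruct (contiguity M H2 1 0
      ((M + 1) ^ 3 / (2 * M + 1) * 1 + 0 * 0)
      ((M + 1) ^ 3 / (2 * M + 1) * 0 + 0 * 0)) with (m := m) as [E _];
      [ring|ring|].
    rewrite cfrac_rec_lin in E. cbn [fst] in E. unfold dens at 1, p, q, k.
    rewrite <- E. fold (dens (elem (M + 1)) (2 * m)). ring. }
  assert (EN : comb (nums (elem M) (2 * m)) p q =
    M ^ 3 / (2 * M + 1) * (fst (nums (elem (M + 1)) (2 * m))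
                           + 2 * fst (dens (elem (M + 1)) (2 * m)))).
  { destruct (contiguity M H2 (M - 1) 1
      (M ^ 3 / (2 * M + 1) * (M + 1 - 1) + 2 * (M ^ 3 / (2 * M + 1)) * 1)
      (M ^ 3 / (2 * M + 1) * 1 + 2 * (M ^ 3 / (2 * M + 1)) * 0)) with (m := m)
      as [E _]; [field; auto|field; auto|].
    rewrite cfrac_rec_lin in E. cbn [fst] in E. unfold nums at 1, p, q, k.
    unfold elem at 2. rewrite <- E.
    unfold nums, dens. unfold elem at 4. ring. }
  rewrite ED in *. rewrite EN. unfold convergent, cfrac_num, cfrac_den.
  fold (nums (elem (M + 1)) (2 * m)) (dens (elem (M + 1)) (2 * m)).
  assert (fst (dens (elem (M + 1)) (2 * m)) <> 0).
  { intros E. apply Hnz. rewrite E. ring. }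
  field. auto.
Qed.

(** The first weight is [m^2] plus a term of nonnegative real part plus a
    constant, which [m^2] eventually absorbs; the second one is a positive real
    number. *)
Lemma shift_pair_right_half_plane M (HM : (0 < Re M)%R) :
  eventually (fun m : nat =>
    let k := RtoC (INR m) in
    (0 <= Re ((k ^ 2 + (M + 2) * k + (M + 1) ^ 3 / (2 * M + 1))
              * Cconj ((k + 1) ^ 2)))%R).
Proof.
  set (c := (M + 1) ^ 3 / (2 * M + 1)).
  destruct (nfloor_ex (Cmod c) (Cmod_ge_0 c)) as [N HN].
  exists (S N). intros m Hm. cbv zeta.
  apply le_INR in Hm. rewrite S_INR in Hm.
  assert (Hc : (- Re c <= Cmod c)%R).
  { eapply Rle_trans; [|apply re_le_Cmod]. rewrite <- Rabs_Ropp. apply Rle_abs. }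
  pose proof (pos_INR N).
  set (x := INR m) in *.
  replace (Re _) with ((x ^ 2 + (Re M + 2) * x + Re c) * (x + 1) ^ 2)%R
    by (destruct M, c; simpl; ring).
  apply Rmult_le_pos; [|apply pow2_ge_0].
  assert (x <= x ^ 2)%R by nra.
  assert (0 <= (Re M + 2) * x)%R by (apply Rmult_le_pos; lra).
  lra.
Qed.

Lemma in_discs_succ M (HM : (0 < Re M)%R) f :
  in_discs (elem M) f -> in_discs (elem (M + 1)) (((M + 1) / M) ^ 3 * f - 2).
Proof.
  intros Hf.
  assert (HM1 : (0 < Re (M + 1))%R) by (rewrite Re_plus_R; lra).
  assert (H0 : M <> 0) by (apply Re_pos_nz; auto).
  assert (H1 : M + 1 <> 0) by (apply Re_pos_nz; auto).
  pose proof (inv_diameter_elem_lim M HM) as L.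
  pose proof (inv_diameter_elem_lim _ HM1) as L1.
  destruct (in_discs_exists (elem (M + 1))) as [f' Hf'].
  { intros n. apply Rlt_le, Re_elem_pos, HM1. }
  { exact L1. }
  set (c := (M / (M + 1)) ^ 3) in *.
  assert (HD : c * (f' + 2) - f = 0).
  { apply Cmod_eq_0. apply Rle_antisym; [|apply Cmod_ge_0].
    apply le_epsilon. intros eps He. rewrite Rplus_0_l.
    apply is_lim_seq_spec in L. apply is_lim_seq_spec in L1.
    (* The difference is bounded by [|c| / S'] for the convergent at [M + 1] and
       by [2 / S] for the modified convergent and the convergent at [M]. *)
    set (K := ((Cmod c + 2) / eps)%R).
    assert (HK : (0 < K)%R).
    { apply Rdiv_lt_0_compat; [|lra]. pose proof (Cmod_ge_0 c). lra. }
    destruct (filter_and _ _ (L K) (L1 K)) as [N HN].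
    destruct (shift_pair_right_half_plane M HM) as [N' HN'].
    set (m := (N + N')%nat).
    specialize (HN (2 * m)%nat ltac:(lia)). specialize (HN' m ltac:(lia)).
    cbv zeta beta in HN, HN'. destruct HN as [HS HS1].
    destruct (disc_bound (elem M) (2 * m) _ _ ltac:(lra) HN') as [Hnz Hdisc].
    { right. apply Cpow_nz. apply (INR_succ_nz m 0). }
    rewrite modified_convergent_shift in Hdisc by auto. fold c in Hdisc.
    pose proof (Hf (2 * m)%nat ltac:(lra)) as B.
    pose proof (Hf' (2 * m)%nat ltac:(lra)) as B'.
    set (u := convergent _ (elem M) _) in *.
    set (u' := convergent _ (elem (M + 1)) _) in *.
    replace (c * (f' + 2) - f) with
      (- (c * (u' - f')) + ((c * (u' + 2) - u) + (u - f))) by ring.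
    eapply Rle_trans; [apply Cmod_triangle|].
    rewrite Cmod_opp, Cmod_mult.
    pose proof (Cmod_triangle (c * (u' + 2) - u) (u - f)).
    assert (I : (/ inv_diameter (elem M) (2 * m) <= / K)%R)
      by (apply Rinv_le_contravar; lra).
    assert (I1 : (/ inv_diameter (elem (M + 1)) (2 * m) <= / K)%R)
      by (apply Rinv_le_contravar; lra).
    pose proof (Rmult_le_compat_l (Cmod c) _ _ (Cmod_ge_0 c) (Rle_trans _ _ _ B' I1)).
    replace eps with (Cmod c * / K + 2 * / K)%R; [lra|].
    unfold K. field. pose proof (Cmod_ge_0 c). split; lra. }
  replace (((M + 1) / M) ^ 3 * f - 2) with f'; [exact Hf'|].
  assert (E : f = c * (f' + 2)).
  { transitivity (c * (f' + 2) - (c * (f' + 2) - f)); [ring|rewrite HD; ring]. }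
  rewrite E. unfold c. field. auto.
Qed.

(** * Summation *)

(** The first convergent is [M - 1 + 1 / (2 M)], and [S_1 = 2 Re M]. *)
Lemma in_discs_near M (HM : (0 < Re M)%R) f :
  in_discs (elem M) f -> (Cmod (f - (M - 1)) <= / Re M)%R.
Proof.
  intros Hf.
  assert (H0 : M <> 0) by (apply Re_pos_nz; auto).
  assert (E1 : elem M 1 = 2 * M).
  { etransitivity; [exact (elem_odd M 0)|]. simpl (INR 0). field. }
  assert (ER : inv_diameter (elem M) 1 = (2 * Re M)%R).
  { unfold inv_diameter, dens. rewrite cfrac_rec_succ. cbn [fst snd cfrac_rec].
    rewrite E1. destruct M; simpl; ring. }
  specialize (Hf 1%nat ltac:(lra)). rewrite ER in Hf.
  assert (EC : convergent (fun _ => 1) (elem M) 1 = M - 1 + / (2 * M)).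
  { unfold convergent, cfrac_num, cfrac_den. rewrite !cfrac_rec_succ.
    cbn [fst snd cfrac_rec]. rewrite E1. unfold elem. field. auto. }
  rewrite EC in Hf.
  replace (f - (M - 1)) with (- (M - 1 + / (2 * M) - f) + / (2 * M))
    by (field; auto).
  eapply Rle_trans; [apply Cmod_triangle|]. rewrite Cmod_opp.
  assert (H2 : 2 * M <> 0) by (apply Cmult_neq_0; [|auto]; intros E; apply RtoC_inj in E; lra).
  rewrite (Cmod_inv _ H2).
  assert (/ Cmod (2 * M) <= / (2 * Re M))%R.
  { apply Rinv_le_contravar; [lra|].
    rewrite Cmod_mult, Cmod_R, Rabs_pos_eq by lra.
    apply Rmult_le_compat_l; [lra|].
    eapply Rle_trans; [apply Rle_abs|apply re_le_Cmod]. }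
  replace (/ Re M)%R with (/ (2 * Re M) + / (2 * Re M))%R by (field; lra).
  lra.
Qed.

(** The functional equation in the form [H(Z+1) = H(Z) - 1 / (Z+1)^3]. *)
Lemma in_discs_add_nat M (HM : (0 < Re M)%R) h :
  in_discs (elem M) (2 * M ^ 3 * h) ->
  forall N : nat,
  let Z := M + RtoC (INR (S N)) in
  in_discs (elem Z) (2 * Z ^ 3 * (h - sum_n (lerch_term 1 3 (M + 1)) N)).
Proof.
  intros Hh N. induction N as [|N IH]; cbv zeta in *.
  - pose proof (in_discs_succ M HM _ Hh) as H.
    assert (H0 : M <> 0) by (apply Re_pos_nz; auto).
    assert (H1 : M + 1 <> 0) by (apply Re_pos_nz; rewrite Re_plus_R; lra).
    rewrite sum_O. unfold lerch_term. simpl (INR 0). simpl (INR 1).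
    match goal with |- in_discs _ ?x => match type of H with in_discs _ ?y =>
      replace x with y end end; [exact H|].
    field. auto.
  - set (Z := M + RtoC (INR (S N))) in *.
    assert (HZ : (0 < Re Z)%R).
    { unfold Z. rewrite re_plus. pose proof (pos_INR (S N)).
      change (Re (RtoC (INR (S N)))) with (INR (S N)). lra. }
    pose proof (in_discs_succ Z HZ _ IH) as H.
    assert (H0 : Z <> 0) by (apply Re_pos_nz; auto).
    assert (H1 : Z + 1 <> 0) by (apply Re_pos_nz; rewrite Re_plus_R; lra).
    rewrite sum_Sn.
    replace (M + RtoC (INR (S (S N)))) with (Z + 1)
      by (unfold Z; rewrite (S_INR (S N)), RtoC_plus; ring).
    match goal with |- in_discs _ ?x => match type of H with in_discs _ ?y =>
      replace x with y end end; [exact H|].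
    set (s := sum_n _ _). change (plus s ?t) with (s + t).
    unfold lerch_term. rewrite Cpow_1_l.
    replace (RtoC (INR (S N)) + (M + 1)) with (Z + 1) by (unfold Z; ring).
    field. auto.
Qed.

(** With [Z = M + n + 1], the remainder times [2 Z^3] is within 1 of [Z - 1], so
    the remainder is [O(1 / |Z|^2)]; the cruder bound [2 / |Z|] suffices. *)
Lemma is_series_lerch M (HM : (0 < Re M)%R) h :
  in_discs (elem M) (2 * M ^ 3 * h) ->
  is_series (V := C_NormedModule) (lerch_term 1 3 (M + 1)) h.
Proof.
  intros Hh. apply filterlim_Cmod. intros eps He.
  destruct (nfloor_ex (2 / eps)) as [N HN].
  { apply Rlt_le, Rdiv_lt_0_compat; lra. }
  exists N. intros n Hn.
  pose proof (in_discs_add_nat M HM h Hh n) as H. cbv zeta in H.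
  set (Z := M + RtoC (INR (S n))) in *.
  set (s := sum_n _ n) in *.
  pose proof (pos_INR n) as Hn0.
  assert (HZ : (INR n + 1 < Re Z)%R).
  { unfold Z. rewrite Re_plus_R, S_INR. lra. }
  assert (HX : (INR n + 1 < Cmod Z)%R).
  { eapply Rlt_le_trans; [exact HZ|].
    eapply Rle_trans; [apply Rle_abs|apply re_le_Cmod]. }
  pose proof (in_discs_near Z ltac:(lra) _ H) as B.
  assert (Hr : (/ Re Z <= 1)%R).
  { rewrite <- Rinv_1. apply Rinv_le_contravar; lra. }
  assert (T : (2 * Cmod Z ^ 3 * Cmod (s - h) <= 3 * Cmod Z)%R).
  { replace (2 * Cmod Z ^ 3 * Cmod (s - h))%R
      with (Cmod (2 * Z ^ 3 * (h - s))).
    - replace (2 * Z ^ 3 * (h - s))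
        with ((2 * Z ^ 3 * (h - s) - (Z - 1)) + (Z + - (1))) by ring.
      eapply Rle_trans; [apply Cmod_triangle|].
      pose proof (Cmod_triangle Z (- (1))) as HT. rewrite Cmod_opp, Cmod_1 in HT.
      lra.
    - rewrite !Cmod_mult, Cmod_pow, Cmod_R, Rabs_pos_eq by lra.
      rewrite <- (Cmod_opp (s - h)). do 2 apply f_equal. ring. }
  set (X := Cmod Z) in *. set (t := Cmod (s - h)) in *.
  assert (Ht : (0 <= t)%R) by apply Cmod_ge_0.
  apply le_INR in Hn.
  assert (T2 : (X * t <= 2)%R).
  { apply Rmult_le_reg_l with (X ^ 2)%R; [apply pow_lt; lra|].
    assert (X <= X ^ 2)%R by nra. lra. }
  assert (Hk : (2 < eps * X)%R).
  { replace 2%R with (eps * (2 / eps))%R by (field; lra).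
    apply Rmult_lt_compat_l; lra. }
  apply Rmult_lt_reg_l with X; lra.
Qed.

Lemma elem_spec M (b : nat -> C) :
  b 0%nat = M - 1 ->
  (forall n : nat, (1 <= n)%nat -> b (2 * n - 1)%nat = 2 * M / RtoC (INR n)) ->
  (forall n : nat, (1 <= n)%nat ->
     b (2 * n)%nat =
       M * RtoC (INR (2 * n + 1)) / (RtoC (INR n) * RtoC (INR (n + 1)))) ->
  b = elem M.
Proof.
  intros h0 hodd heven. apply functional_extensionality. intros n.
  destruct n as [|n]; [exact h0|].
  destruct (Nat.Even_or_Odd n) as [[m ->]|[m ->]].
  - replace (S (2 * m)) with (2 * m + 1)%nat by lia. rewrite elem_odd.
    specialize (hodd (S m) ltac:(lia)).
    replace (2 * S m - 1)%nat with (2 * m + 1)%nat in hodd by lia.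
    rewrite hodd, S_INR, RtoC_plus. reflexivity.
  - replace (S (2 * m + 1)) with (2 * m + 2)%nat by lia. rewrite elem_even.
    specialize (heven (S m) ltac:(lia)).
    replace (2 * S m)%nat with (2 * m + 2)%nat in heven by lia.
    rewrite heven.
    replace (INR (2 * m + 2 + 1)) with (2 * INR m + 3)%R
      by (rewrite !plus_INR, mult_INR; simpl; ring).
    replace (INR (S m + 1)) with (INR m + 2)%R
      by (rewrite plus_INR, S_INR; simpl; ring).
    rewrite S_INR, !RtoC_plus, RtoC_mult. reflexivity.
Qed.

Theorem theorem4 (M : C) (b : nat -> C)
  (hM : (0 < Re M)%R)
  (hb0 : b 0%nat = M - 1)
  (hbodd : forall n : nat, (1 <= n)%nat ->
     b (2 * n - 1)%nat = 2 * M / RtoC (INR n))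
  (hbeven : forall n : nat, (1 <= n)%nat ->
     b (2 * n)%nat =
       M * RtoC (INR (2 * n + 1)) / (RtoC (INR n) * RtoC (INR (n + 1)))) :
  ex_lerch 1 3 (M + 1) /\
  ex_cfrac (fun _ => 1) b /\
  2 * M ^ 3 * lerch 1 3 (M + 1) = 2 * M ^ 3 * hurwitz_zeta 3 (M + 1) /\
  2 * M ^ 3 * hurwitz_zeta 3 (M + 1) = cfrac (fun _ => 1) b.
Proof.
  rewrite (elem_spec M b hb0 hbodd hbeven). clear b hb0 hbodd hbeven.
  pose proof (inv_diameter_elem_lim M hM) as L.
  destruct (in_discs_exists (elem M)) as [f Hf].
  { intros n. apply Rlt_le, Re_elem_pos, hM. }
  { exact L. }
  pose proof (in_discs_is_cfrac _ _ L Hf) as Hcf.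
  assert (H0 : M <> 0) by (apply Re_pos_nz; auto).
  set (h := f / (2 * M ^ 3)).
  assert (Ef : f = 2 * M ^ 3 * h) by (unfold h; field; auto).
  rewrite Ef in Hf. apply (is_series_lerch M hM) in Hf.
  assert (EL : lerch 1 3 (M + 1) = h).
  { apply (iota_unique (V := C_CompleteNormedModule)); [|exact Hf].
    intros y Hy.
    exact (filterlim_locally_unique (V := C_NormedModule) _ _ _ Hy Hf). }
  assert (EC : cfrac (fun _ => 1) (elem M) = f).
  { apply (iota_unique (V := C_CompleteNormedModule)); [|exact Hcf].
    intros y [_ Hy].
    exact (filterlim_locally_unique (V := C_NormedModule) _ _ _ Hy (proj2 Hcf)). }
  split; [now exists h|]. split; [now exists f|]. split; [reflexivity|].
  unfold hurwitz_zeta. rewrite EL, EC. now symmetry.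
Qed.
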